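(* Let $n\ge3$ and let $A\in\mathbb{R}^{n\times n}$ be a symmetric matrix with only two distinct eigenvalues, such that its smallest eigenvalue has multiplicity one. Then the function $q_A:\mathbb{S}^{n-1}\cap\mathbb{R}^n_{++}\to\mathbb{R}$, $q_A(x)=\langle Ax,x\rangle$, is spherically quasi-convex if and only if there is an eigenvector of $A$ corresponding to the smallest eigenvalue with all components nonnegative.
   Context: $\mathbb{S}^{n-1}=\{x\in\mathbb{R}^n:\|x\|=1\}$ and $\mathbb{R}^n_{++}$ is the set of vectors with positive entries. For $x,y\in\mathbb{S}^{n-1}$ with $y\ne\pm x$ the minimal geodesic from $x$ to $y$ is the constant-speed parametrization $[0,1]\to\mathbb{S}^{n-1}$ of the shorter great-circle arc from $x$ to $y$. A function $f:\mathcal{S}\to\mathbb{R}$ on $\mathcal{S}=\mathbb{S}^{n-1}\cap\mathbb{R}^n_{++}$ is spherically quasi-convex if for every minimal geodesic segment $\gamma:[0,1]\to\mathcal{S}$ the composition $f\circ\gamma$ is quasi-convex in the usual sense. *)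

(* Defs.v *)
From mathcomp Require Export all_boot all_order all_algebra.
From mathcomp Require Export classical_sets reals trigo.

Set Implicit Arguments.
Unset Strict Implicit.
Unset Printing Implicit Defensive.

Import Order.TTheory GRing.Theory Num.Theory.

Local Open Scope classical_set_scope.
Local Open Scope ring_scope.

Definition dot (R : realType) (n : nat) (x y : 'cV[R]_n) : R :=
  \sum_i x i 0 * y i 0.

(* The library norm on matrices is the sup norm, hence this one. *)
Definition enorm (R : realType) (n : nat) (x : 'cV[R]_n) : R :=
  Num.sqrt (dot x x).

Definition unit_sphere (R : realType) (n : nat) : set 'cV[R]_n :=
  [set x | enorm x = 1].

Definition pos_orthant (R : realType) (n : nat) : set 'cV[R]_n :=
  [set x | forall i, 0 < x i 0].

(* For [x], [y] on the unit sphere with [y] different from [x] and [- x], the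
   unit vector tangent to the sphere at [x] and pointing towards [y]. *)
Definition tangent_dir (R : realType) (n : nat) (x y : 'cV[R]_n) : 'cV[R]_n :=
  let w := y - dot x y *: x in (enorm w)^-1 *: w.

(* The great circle through [x] with initial direction [tangent_dir x y], run
   for [t] in [0, 1] at constant speed [acos (dot x y)], the angle between [x]
   and [y]. This angle is less than pi, so the arc is the shorter one. *)
Definition min_geodesic (R : realType) (n : nat) (x y : 'cV[R]_n) (t : R) :
    'cV[R]_n :=
  let d := acos (dot x y) in
  cos (t * d) *: x + sin (t * d) *: tangent_dir x y.

Definition quasi_convex01 (R : realType) (g : R -> R) : Prop :=
  forall s t l : R, 0 <= s <= 1 -> 0 <= t <= 1 -> 0 <= l <= 1 ->
    g ((1 - l) * s + l * t) <= Num.max (g s) (g t).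

(* [f] stands for a function defined on [S] only: its values outside [S] are
   never used. *)
Definition spherically_quasi_convex (R : realType) (n : nat)
    (S : set 'cV[R]_n) (f : 'cV[R]_n -> R) : Prop :=
  forall x y : 'cV[R]_n, unit_sphere x -> unit_sphere y ->
    y <> x -> y <> - x ->
    (forall t : R, 0 <= t <= 1 -> S (min_geodesic x y t)) ->
    quasi_convex01 (fun t => f (min_geodesic x y t)).

Definition quad (R : realType) (n : nat) (A : 'M[R]_n) (x : 'cV[R]_n) : R :=
  dot (A *m x) x.

(* Main.v *)
Require Import Defs.
From mathcomp Require Import sesquilinear spectral complex ring lra.
Import Order.TTheory GRing.Theory Num.Theory.
Local Open Scope classical_set_scope.
Local Open Scope ring_scope.

Set Implicit Arguments.
Unset Strict Implicit.
Unset Printing Implicit Defensive.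

(** The hypotheses on the spectrum say that [A] is a scalar matrix minus a
    positive multiple of a projection onto a line: for a unit eigenvector [v] for
    [lmin], [A = lmax - (lmax - lmin) *: (v *m v^T)]
    ([two_eigenvalue_normal_form]). On the unit sphere the quadratic form is
    therefore [lmax - (lmax - lmin) * dot v x ^+ 2], and its quasi-convexity on
    the positive part of the sphere is the quasi-concavity of [`|dot v x|] there.

    Along a great circle [dot v] is a sinusoid of the angle. If [v], or [- v], has
    nonnegative coordinates, this sinusoid has constant sign on a geodesic that
    stays in the orthant, and a nonnegative sinusoid on an arc shorter than [pi]
    is quasi-concave ([sinusoid_quasi_concave], [quasi_convex_sub_sqr_dot]).

    If [v] has coordinates of both signs, the hyperplane orthogonal to [v] meets
    the open orthant. Two distinct points of it that are symmetric with respect to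
    that hyperplane give the form one and the same value below [lmax], but their
    geodesic crosses the hyperplane, where the form equals [lmax]
    ([not_quasi_convex_mixed_sign]). Since the eigenspace of [lmin] is the line
    of [v], a nonnegative eigenvector exists exactly in the first case. *)

(** * Symmetric matrices with two eigenvalues *)

(** Over the complex numbers the matrix is Hermitian, so the spectral theorem
    makes it similar to a diagonal matrix with real entries. Two real matrices
    that are similar over the complex numbers are similar over the reals, and
    this brings the diagonalization back to [R]. *)
Lemma symmetric_diagonalizable (R : rcfType) n (A : 'M[R]_n) : A^T = A ->
  exists (P : 'M[R]_n) (d : 'rV[R]_n),
    P \in unitmx /\ A = invmx P *m diag_mx d *m P.
Proof.
move=> Asym; pose toC := real_complex R.
have toCreal m p (M : 'M[R]_(m, p)) : map_mx toC M \is a mxOver Num.real.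
  by apply/mxOverP => i j; rewrite mxE; apply/complex_realP; exists (M i j).
have ofCreal m p (M : 'M[R[i]]_(m, p)) : M \is a mxOver Num.real ->
    map_mx toC (map_mx (@complex.Re R) M) = M.
  move=> /mxOverP Mreal; apply/matrixP => i j.
  by rewrite !mxE; apply: RRe_real.
set B := map_mx toC A.
have Bherm : B \is hermsymmx.
  apply: realsym_hermsym; last exact: toCreal.
  apply/is_hermitianmxP; rewrite expr0 scale1r; apply/matrixP => i j.
  by rewrite !mxE -[in LHS]Asym mxE.
have := hermitian_normalmx Bherm => /orthomx_spectralP.
have := hermitian_spectral_diag_real Bherm.
set Q := spectralmx B; set e := spectral_diag B => ereal Bdiag.
have /= : similar_in unitmx B (diag_mx e).
  exists Q; first exact: spectral_unit.
  apply/similarP; first exact: spectral_unit.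
  by rewrite {1}Bdiag !mulmxA mulmxV ?spectral_unit // mul1mx.
move=> /real_similar [].
- exact: toCreal.
- by apply/mxOverP=> i j; rewrite mxE; apply: rpredMn; move/mxOverP: ereal; apply.
move=> P /andP[Preal Punit] /similarP -/(_ Punit) /=.
rewrite -(ofCreal _ _ _ Preal) -(ofCreal _ _ _ ereal) in Punit *.
set P' := map_mx _ P; set d := map_mx _ e.
rewrite /B -map_diag_mx -!map_mxM => /map_mx_inj PA.
rewrite map_unitmx in Punit.
by exists P', d; split=> //; rewrite -mulmxA -PA mulKmx.
Qed.

Lemma char_poly_similar (F : fieldType) n (P M : 'M[F]_n) : P \in unitmx ->
  char_poly (invmx P *m M *m P) = char_poly M.
Proof.
move=> Punit; rewrite /char_poly /char_poly_mx.
set f := map_mx (@polyC F).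
have fV : f (invmx P) *m f P = 1%:M by rewrite /f -map_mxM mulVmx // map_mx1.
have -> : 'X%:M - f (invmx P *m M *m P) = f (invmx P) *m ('X%:M - f M) *m f P.
  rewrite mulmxBr mulmxBl /f !map_mxM -/f scalar_mxC.
  by rewrite -[_%:M *m _ *m _]mulmxA fV mulmx1.
by rewrite !det_mulmx mulrAC -det_mulmx fV det1 mul1r.
Qed.

(** In a diagonalization the multiplicity one of [lmin] singles out one diagonal
    entry [i0], so [lmax - A] is similar to [lmax - lmin] times the matrix unit
    at [i0]: it is [lmax - lmin] times the product of a column [u] and a row [w]
    with [w *m u = 1]. Symmetry makes [u] proportional to the transpose of [w], and
    rescaling that vector to unit length turns the product into [v *m v^T]. *)
Lemma two_eigenvalue_normal_form (R : rcfType) n (A : 'M[R]_n) (lmin lmax : R) :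
    A^T = A ->
    (forall a, eigenvalue A a -> a = lmin \/ a = lmax) ->
    lmin <> lmax -> mup lmin (char_poly A) = 1%N ->
  exists v : 'cV[R]_n,
    v^T *m v = 1%:M /\ A = lmax%:M - (lmax - lmin) *: (v *m v^T).
Proof.
move=> Asym spec /eqP neq_l mult.
have [P [d [Punit Ad]]] := symmetric_diagonalizable Asym.
have charA : char_poly A = \prod_i ('X - (d 0 i)%:P).
  rewrite Ad char_poly_similar // char_poly_trig ?diag_mx_is_trig //.
  by apply: eq_bigr => i _; rewrite mxE eqxx.
have dspec i : d 0 i = lmin \/ d 0 i = lmax.
  apply: spec; rewrite eigenvalue_root_char charA /root horner_prod.
  by rewrite (bigD1 i) //= hornerXsubC subrr mul0r.
(* The multiplicity of the root [lmin] counts the entries of [d] equal to it. *)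
have [i0 di0] : exists i0, forall i, (d 0 i == lmin) = (i == i0).
  move: mult; rewrite charA.
  rewrite -(big_map (d 0) xpredT (fun y => 'X - y%:P)) mu_prod_XsubC count_map.
  rewrite -size_filter; set s := filter _ _ => s1.
  have mem_s i : (i \in s) = (d 0 i == lmin).
    by rewrite mem_filter /= mem_index_enum andbT.
  case: s s1 mem_s => [|i0 []] // _ mem_s.
  by exists i0 => i; rewrite -mem_s inE.
pose u := col i0 (invmx P); pose w := row i0 P.
have wu : w *m u = 1%:M.
  rewrite /w /u -row_mul; apply/matrixP=> i j.
  rewrite !ord1 !mxE (eq_bigr (fun k => P i0 k * invmx P k i0)); last first.
    by move=> k _; rewrite !mxE.
  have /matrixP/(_ i0 i0) := mulmxV Punit; rewrite !mxE eqxx => <- //.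
have Auw : A = lmax%:M - (lmax - lmin) *: (u *m w).
  have -> : u *m w = invmx P *m delta_mx i0 i0 *m P.
    by rewrite /u /w colE rowE -!mulmxA; congr (_ *m _); rewrite mulmxA mul_delta_mx.
  have -> : lmax%:M = invmx P *m lmax%:M *m P :> 'M[R]_n.
    by rewrite scalar_mxC -mulmxA mulVmx // mulmx1.
  rewrite scalemxAl scalemxAr -mulmxBl -mulmxBr Ad; congr (_ *m _ *m _).
  apply/matrixP => i j; rewrite !mxE.
  have [<-|ij] := eqVneq i j; last first.
    have -> : (i == i0) && (j == i0) = false.
      by apply/negbTE; apply: contra ij => /andP[/eqP-> /eqP->].
    by rewrite !mulr0n mulr0 subr0.
  rewrite !mulr1n andbb; have := di0 i; case: (dspec i) => ->.
    by rewrite eqxx => <-; rewrite !mulr1 subKr.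
  by rewrite eq_sym (negPf neq_l) => <-; rewrite mulr0 subr0.
(* [lmax - A] is symmetric, and [lmax - lmin] can be cancelled. *)
have swap : u *m w = w^T *m u^T.
  rewrite -trmx_mul; move: Asym; rewrite {1 2}Auw linearB linearZ /= tr_scalar_mx.
  move=> /addrI/oppr_inj/scalerI -> //.
  by rewrite subr_eq0 eq_sym.
pose k := (u^T *m u) 0 0; pose m := (w *m w^T) 0 0.
have uE : u = k *: w^T.
  by rewrite -[LHS]mulmx1 -wu mulmxA swap -mulmxA [_ *m u]mx11_scalar mul_mx_scalar.
have km : k * m = 1.
  have /matrixP/(_ 0 0) := wu; rewrite uE -scalemxAr mxE -/m => ->.
  by rewrite !mxE.
have m0 : 0 < m.
  rewrite lt0r; apply/andP; split.
    by apply/eqP => m0; move: km; rewrite m0 mulr0 => /esym/eqP; rewrite oner_eq0.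
  by rewrite /m mxE sumr_ge0 // => i _; rewrite [w^T _ _]mxE -expr2 sqr_ge0.
have sm : (Num.sqrt m)^-1 * (Num.sqrt m)^-1 = k.
  rewrite -invfM -expr2 sqr_sqrtr ?(ltW m0) //.
  by apply: (mulIf (lt0r_neq0 m0)); rewrite km mulVf // lt0r_neq0.
have vT : ((Num.sqrt m)^-1 *: w^T)^T = (Num.sqrt m)^-1 *: w.
  by rewrite linearZ /= trmxK.
exists ((Num.sqrt m)^-1 *: w^T); rewrite vT; split.
  rewrite -scalemxAl -scalemxAr scalerA sm.
  by rewrite [_ *m _]mx11_scalar -/m scale_scalar_mx km.
rewrite {1}Auw -scalemxAl -scalemxAr [_ *: (_ *: (_ *m _))]scalerA sm.
by rewrite scalemxAl -uE.
Qed.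

(** * The inner product *)

Section Dot.
Variables (R : realType) (n : nat).
Implicit Types (x y z : 'cV[R]_n) (a : R).

Lemma dotC x y : dot x y = dot y x.
Proof. by apply: eq_bigr => i _; rewrite mulrC. Qed.

Lemma dotDr x y z : dot x (y + z) = dot x y + dot x z.
Proof. by rewrite -big_split; apply: eq_bigr => i _; rewrite mxE mulrDr. Qed.

Lemma dotZr a x y : dot x (a *: y) = a * dot x y.
Proof. by rewrite mulr_sumr; apply: eq_bigr => i _; rewrite mxE mulrCA. Qed.

Lemma dotNr x y : dot x (- y) = - dot x y.
Proof. by rewrite -scaleN1r dotZr mulN1r. Qed.

Lemma dotDl x y z : dot (y + z) x = dot y x + dot z x.
Proof. by rewrite dotC dotDr ![dot x _]dotC. Qed.

Lemma dotZl a x y : dot (a *: y) x = a * dot y x.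
Proof. by rewrite dotC dotZr dotC. Qed.

Lemma dotNl x y : dot (- y) x = - dot y x.
Proof. by rewrite dotC dotNr dotC. Qed.

Definition dotE := (dotDl, dotDr, dotZl, dotZr, dotNl, dotNr).

Lemma dot_ge0 x : 0 <= dot x x.
Proof. by apply: sumr_ge0 => i _; rewrite -expr2 sqr_ge0. Qed.

Lemma sqr_coord_le_dot x i : x i 0 ^+ 2 <= dot x x.
Proof.
rewrite /dot (bigD1 i) //= -expr2 lerDl.
by apply: sumr_ge0 => j _; rewrite -expr2 sqr_ge0.
Qed.

Lemma dot_gt0 x : x != 0 -> 0 < dot x x.
Proof.
apply: contraNT; rewrite -leNgt => x0; apply/eqP/colP => i; rewrite mxE.
apply/eqP; rewrite -sqrf_eq0 eq_le sqr_ge0 andbT.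
exact: le_trans (sqr_coord_le_dot x i) x0.
Qed.

Lemma unit_sphereP x : unit_sphere x <-> dot x x = 1.
Proof.
rewrite /unit_sphere /enorm /=; split=> [x1|->]; last exact: sqrtr1.
by rewrite -[LHS]sqr_sqrtr ?dot_ge0 // x1 expr1n.
Qed.

Lemma mulmx_tr_dot x y : x^T *m y = (dot x y)%:M.
Proof.
rewrite [LHS]mx11_scalar mxE; congr _%:M.
by apply: eq_bigr => i _; rewrite mxE.
Qed.

End Dot.

(** * Sinusoids *)

Section Sinusoid.
Variable R : realType.
Implicit Types a b p q phi : R.

Definition sinusoid p q phi := cos phi * p + sin phi * q.

(** The three sinusoids [p * cos + q * sin], [sin (b - _)] and [sin (_ - a)] live
    in a space of dimension two; this is the relation between them. Applied to
    the coordinates of a great circle it is spherical interpolation. *)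
Lemma sinusoid_interpolation a b p q phi :
  sin (b - a) * sinusoid p q phi =
  sin (b - phi) * sinusoid p q a + sin (phi - a) * sinusoid p q b.
Proof. by rewrite /sinusoid !sinB; ring. Qed.

(** Expand [sin (a + b)]; both sines are nonnegative and both cosines are at
    most [1]. *)
Lemma sin_subadditive a b : 0 <= a <= pi -> 0 <= b <= pi ->
  sin (a + b) <= sin a + sin b.
Proof.
move=> /sin_ge0_pi sa /sin_ge0_pi sb; rewrite sinD.
by apply: lerD; rewrite (ler_piMr, ler_piMl) // cos_le1.
Qed.

(** On an arc shorter than [pi], interpolation writes the value at [phi] as a
    combination of the values at [a] and [b] with nonnegative coefficients,
    and these coefficients add up to at least [1] by subadditivity of the sine.
    Since the end values are nonnegative, the result is at least their
    minimum. *)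
Lemma sinusoid_quasi_concave a b p q phi : a <= phi <= b -> b - a < pi ->
    0 <= sinusoid p q a -> 0 <= sinusoid p q b ->
  Num.min (sinusoid p q a) (sinusoid p q b) <= sinusoid p q phi.
Proof.
move=> /andP[a_phi phi_b] ab_pi ga gb.
(* In the degenerate case the interpolation formula reads [0 = 0]. *)
have [ab|ab] := leP b a.
  have -> : phi = a by apply/eqP; rewrite eq_le a_phi (le_trans phi_b).
  by rewrite ge_min lexx.
have S0 : 0 < sin (b - a) by apply: sin_gt0_pi; rewrite subr_gt0 ab.
have I1 : 0 <= b - phi <= pi by lra.
have I2 : 0 <= phi - a <= pi by lra.
have s1 := sin_ge0_pi I1; have s2 := sin_ge0_pi I2.
have := sin_subadditive I1 I2; rewrite subrKA => S12.
rewrite -(ler_pM2l S0) sinusoid_interpolation.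
set m := Num.min _ _.
have m0 : 0 <= m by rewrite le_min ga gb.
apply: (@le_trans _ _ ((sin (b - phi) + sin (phi - a)) * m)).
  by rewrite ler_wpM2r.
rewrite mulrDl; apply: lerD; rewrite ler_wpM2l // ge_min lexx ?orbT //.
Qed.

End Sinusoid.

(** * Minimal geodesics of the sphere *)

Section Geodesic.
Variables (R : realType) (n : nat) (x y : 'cV[R]_n).
Hypotheses (x1 : dot x x = 1) (y1 : dot y y = 1).
Hypotheses (yx : y <> x) (yNx : y <> - x).

Let c := dot x y.
Let d := acos c.

(** Cauchy-Schwarz, strict because [x + y] and [x - y] have positive norm. *)
Lemma dot_unit_lt1 : -1 < c < 1.
Proof.
have := @dot_gt0 R n (y - x); have := @dot_gt0 R n (y + x).
rewrite subr_eq0 addr_eq0 !dotE x1 y1 (dotC y x) -/c.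
move=> /(_ ltac:(exact/eqP)) ? /(_ ltac:(exact/eqP)) ?; lra.
Qed.

Lemma angle_gt0_ltpi : 0 < d < pi.
Proof.
have /andP[c1 c2] := dot_unit_lt1.
by rewrite acos_gt0 ?acos_ltpi // ?c1 ?c2 ?(ltW c1) ?(ltW c2).
Qed.

Lemma sin_angle_gt0 : 0 < sin d.
Proof. exact/sin_gt0_pi/angle_gt0_ltpi. Qed.

Lemma cos_angle : cos d = c.
Proof.
have /andP[c1 c2] := dot_unit_lt1.
by apply: acosK; rewrite in_itv /= !ltW.
Qed.

Lemma tangent_dirE : tangent_dir x y = (sin d)^-1 *: (y - cos d *: x).
Proof.
rewrite /tangent_dir -/c cos_angle; congr (_^-1 *: _).
have /andP[c1 c2] := dot_unit_lt1; rewrite sin_acos ?(ltW c1) ?(ltW c2) //.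
rewrite /enorm !dotE x1 y1 (dotC y x) -/c; congr Num.sqrt; ring.
Qed.

(** Linear functionals restrict to sinusoids on great circles, so that
    statements about [dot w] along a geodesic become statements about
    sinusoids. *)
Lemma dot_geodesic (w : 'cV[R]_n) t :
  dot w (min_geodesic x y t) =
  sinusoid (dot w x) (dot w (tangent_dir x y)) (t * d).
Proof. by rewrite /min_geodesic -/c -/d !dotE. Qed.

Lemma geodesic0 : min_geodesic x y 0 = x.
Proof. by rewrite /min_geodesic mul0r cos0 sin0 scale1r scale0r addr0. Qed.

Lemma geodesic1 : min_geodesic x y 1 = y.
Proof.
rewrite /min_geodesic mul1r -/c -/d tangent_dirE scalerA divff ?scale1r.
  by rewrite addrC subrK.
by rewrite lt0r_neq0 // sin_angle_gt0.
Qed.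

(** This form, symmetric in the end points, shows that the
    coefficients of [x] and [y] are nonnegative along the arc. *)
Lemma geodesic_slerp t :
  sin d *: min_geodesic x y t = sin ((1 - t) * d) *: x + sin (t * d) *: y.
Proof.
have s0 := lt0r_neq0 sin_angle_gt0.
rewrite /min_geodesic -/c -/d tangent_dirE mulrBl mul1r sinB.
apply/colP => i; rewrite !mxE; field.
exact: s0.
Qed.

Lemma geodesic_unit t : dot (min_geodesic x y t) (min_geodesic x y t) = 1.
Proof.
have s0 := lt0r_neq0 sin_angle_gt0.
have xu : dot x (tangent_dir x y) = 0.
  by rewrite tangent_dirE !dotE x1 -/c cos_angle mulr1 subrr mulr0.
have uu : dot (tangent_dir x y) (tangent_dir x y) = 1.
  have ss : 1 - c ^+ 2 = sin d ^+ 2 by rewrite sin2cos2 cos_angle.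
  rewrite tangent_dirE !dotE x1 y1 (dotC y x) -/c cos_angle.
  transitivity ((sin d)^-1 ^+ 2 * (1 - c ^+ 2)); first by ring.
  by rewrite ss -exprMn mulVf ?expr1n.
rewrite /min_geodesic -/c -/d; move: (tangent_dir x y) xu uu => u xu uu.
rewrite !dotE x1 uu (dotC u x) xu -[RHS](cos2Dsin2 (t * d)).
by ring.
Qed.

Lemma geodesic_pos t : (forall i, 0 < x i 0) -> (forall i, 0 < y i 0) ->
  0 <= t <= 1 -> forall i, 0 < min_geodesic x y t i 0.
Proof.
move=> xp yp /andP[t0 t1] i.
have := congr1 (fun z : 'cV_n => z i 0) (geodesic_slerp t); rewrite !mxE => E.
have /andP[d0 dpi] := angle_gt0_ltpi.
rewrite -(pmulr_rgt0 _ sin_angle_gt0) E.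
have s1 : 0 <= sin ((1 - t) * d) by apply: sin_ge0_pi; nra.
have [t00|t00] := eqVneq t 0.
  by rewrite t00 subr0 mul0r mul1r sin0 mul0r addr0 mulr_gt0 // sin_angle_gt0.
have tp : 0 < t by rewrite lt0r t00.
have s2 : 0 < sin (t * d) by apply: sin_gt0_pi; nra.
by rewrite ltr_wpDl ?mulr_gt0 ?mulr_ge0 // ltW.
Qed.
End Geodesic.

(** * Quasi-convexity and the sign of the coordinates *)

Section SignCriterion.
Variables (R : realType) (n : nat).

(** Inside the orthant [dot w] is nonnegative, so along a geodesic it is a
    nonnegative sinusoid, hence quasi-concave; squaring preserves the order of
    nonnegative numbers and the minus sign exchanges concave and convex. *)
Lemma quasi_convex_sub_sqr_dot (A : 'M[R]_n) (w : 'cV[R]_n) (l k : R) :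
    (forall i, 0 <= w i 0) -> 0 <= k ->
    (forall x, dot x x = 1 -> quad A x = l - k * dot w x ^+ 2) ->
  spherically_quasi_convex (@unit_sphere R n `&` @pos_orthant R n) (quad A).
Proof.
move=> w0 k0 qE x y /unit_sphereP x1 /unit_sphereP y1 yx yNx inS.
move=> s t a s01 t01 a01.
set m := (1 - a) * s + a * t.
have m01 : 0 <= m <= 1 by rewrite /m; nra.
have g1 := geodesic_unit x1 y1 yx yNx.
have g0 tau : 0 <= tau <= 1 -> 0 <= dot w (min_geodesic x y tau).
  move=> /inS [_ gp]; apply: sumr_ge0 => i _.
  by rewrite mulr_ge0 // ltW.
have /andP[d0 dpi] := angle_gt0_ltpi x1 y1 yx yNx.
have gmin : Num.min (dot w (min_geodesic x y s)) (dot w (min_geodesic x y t))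
    <= dot w (min_geodesic x y m).
  have := g0 s s01; have := g0 t t01.
  rewrite !dot_geodesic; move: d0 dpi; set d := acos _ => d0 dpi.
  have spread u v : 0 <= u <= 1 -> 0 <= v <= 1 -> v * d - u * d < pi.
    by move=> u01 v01; nra.
  have [st|/ltW ts] := leP s t => gt gs.
    apply: sinusoid_quasi_concave => //; last exact: spread.
    by rewrite !ler_pM2r // /m; nra.
  rewrite minC; apply: sinusoid_quasi_concave => //; last exact: spread.
  by rewrite !ler_pM2r // /m; nra.
rewrite !qE // le_max !lerD2l !lerN2.
have sq tau : 0 <= tau <= 1 ->
    dot w (min_geodesic x y tau) <= dot w (min_geodesic x y m) ->
    k * dot w (min_geodesic x y tau) ^+ 2 <= k * dot w (min_geodesic x y m) ^+ 2.
  by move=> tau01 le_tau; rewrite ler_wpM2l // lerXn2r // nnegrE g0.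
by move: gmin; rewrite ge_min => /orP[/(sq _ s01)|/(sq _ t01)] ->; rewrite ?orbT.
Qed.

(** The all-ones vector can be made orthogonal to [v] by increasing a single
    coordinate: [j] if its product with [v] is nonnegative, [i] otherwise. *)
Lemma orthogonal_ge1 (v : 'cV[R]_n) i j : 0 < v i 0 -> v j 0 < 0 ->
  exists z : 'cV[R]_n, (forall k, 1 <= z k 0) /\ dot v z = 0.
Proof.
move=> vi vj; pose one : 'cV[R]_n := const_mx 1.
have dot_delta k : dot v (delta_mx k 0) = v k 0.
  rewrite /dot (bigD1 k) //= big1 ?addr0 ?mxE ?eqxx ?mulr1 // => l lk.
  by rewrite mxE (negPf lk) mulr0.
have ok k a : 0 <= a -> a * v k 0 = - dot v one ->
    exists z : 'cV[R]_n, (forall k, 1 <= z k 0) /\ dot v z = 0.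
  move=> a0 E; exists (one + a *: delta_mx k 0); split=> [l|].
    by rewrite !mxE lerDl mulr_ge0.
  by rewrite !dotE dot_delta E subrr.
have [s0|s0] := leP 0 (dot v one).
  apply: (ok j (- dot v one / v j 0)); last by rewrite divfK // ltr0_neq0.
  by rewrite mulr_le0 ?invr_le0 ?oppr_le0 // ltW.
apply: (ok i (- dot v one / v i 0)); last by rewrite divfK // lt0r_neq0.
by rewrite divr_ge0 ?oppr_ge0 // ltW.
Qed.

(** With [z] positive and orthogonal to [v], the two points obtained by
    normalizing [z + v / 2] and [z - v / 2] have the same norm before
    normalization and opposite inner products with [v]. Their geodesic therefore
    meets the hyperplane orthogonal to [v] at its midpoint, where the form takes
    its largest value [l], while it takes the same value, less than [l], at both
    ends. *)
Lemma not_quasi_convex_mixed_sign (A : 'M[R]_n) (v : 'cV[R]_n) (l k : R) i j :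
    0 < v i 0 -> v j 0 < 0 -> dot v v = 1 -> 0 < k ->
    (forall x, dot x x = 1 -> quad A x = l - k * dot v x ^+ 2) ->
  ~ spherically_quasi_convex (@unit_sphere R n `&` @pos_orthant R n) (quad A).
Proof.
move=> vi vj v1 k0 qE qc.
have [z [z1 vz]] := orthogonal_ge1 vi vj.
(* The factor [2^-1] keeps both points positive: the coordinates of [z] are at
   least [1], and those of [v] are at most [1] in absolute value. *)
pose x' := z + 2^-1 *: v; pose y' := z - 2^-1 *: v.
have zz : 0 <= dot z z by exact: dot_ge0.
pose N := dot z z + 4^-1.
have N0 : 0 < N by rewrite /N; lra.
have xx : dot x' x' = N by rewrite /x' /N !dotE v1 (dotC z v) vz; field.
have yy : dot y' y' = N by rewrite /y' /N !dotE v1 (dotC z v) vz; field.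
pose r := (Num.sqrt N)^-1.
have r0 : 0 < r by rewrite invr_gt0 sqrtr_gt0.
have rN : r * (r * N) = 1.
  rewrite mulrA -expr2 exprVn sqr_sqrtr ?(ltW N0) // mulVf //.
  by rewrite lt0r_neq0.
pose x := r *: x'; pose y := r *: y'.
have x1 : dot x x = 1 by rewrite /x dotZl dotZr xx.
have y1 : dot y y = 1 by rewrite /y dotZl dotZr yy.
have vle m : -1 <= v m 0 <= 1.
  have := sqr_coord_le_dot v m; rewrite v1 => le1.
  by rewrite -ler_norml -(@ler_pXn2r _ 2) ?nnegrE // expr1n real_normK ?num_real.
have xp m : 0 < x m 0.
  by rewrite !mxE mulr_gt0 //; have := z1 m; have := vle m; lra.
have yp m : 0 < y m 0.
  by rewrite !mxE mulr_gt0 //; have := z1 m; have := vle m; lra.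
have vx : dot v x = r / 2 by rewrite /x /x' !dotE v1 vz; field.
have vy : dot v y = - (r / 2) by rewrite /y /y' !dotE v1 vz; field.
have yx : y <> x by move=> E; move: vy; rewrite E vx; lra.
have yNx : y <> - x.
  by move=> E; have := yp i; rewrite E mxE; have := xp i; lra.
have g1 := geodesic_unit x1 y1 yx yNx.
have gS t : 0 <= t <= 1 ->
    (@unit_sphere R n `&` @pos_orthant R n) (min_geodesic x y t).
  by move=> t01; split; [exact/unit_sphereP | exact: geodesic_pos].
have s0 := sin_angle_gt0 x1 y1 yx yNx.
have vg : dot v (min_geodesic x y 2^-1) = 0.
  apply: (mulfI (lt0r_neq0 s0)); rewrite -dotZr geodesic_slerp //.
  have -> : 1 - 2^-1 = 2^-1 :> R by field.
  rewrite dotDr [dot v (_ *: x)]dotZr [dot v (_ *: y)]dotZr vx vy.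
  by rewrite mulrN subrr mulr0.
have /unit_sphereP ux := x1; have /unit_sphereP uy := y1.
have i0 : (0 : R) <= 0 <= (1 : R) by lra.
have i1 : (0 : R) <= 1 <= (1 : R) by lra.
have ih : (0 : R) <= 2^-1 <= (1 : R) by lra.
have := qc x y ux uy yx yNx gS 0 1 2^-1 i0 i1 ih.
rewrite mulr0 add0r mulr1 geodesic0 geodesic1 //.
rewrite !qE // vg vx vy sqrrN maxxx expr0n /= mulr0 subr0.
have : 0 < k * (r / 2) ^+ 2 by rewrite mulr_gt0 // exprn_gt0 // divr_gt0.
lra.
Qed.
End SignCriterion.

Theorem theorem5p3p2 (R : realType) (n : nat) (A : 'M[R]_n) (lmin lmax : R)
    (hn : (3 <= n)%N) (Asym : A^T = A) (hlt : lmin < lmax)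
    (hspec : forall a : R, eigenvalue A a <-> a = lmin \/ a = lmax)
    (hmult : mup lmin (char_poly A) = 1%N) :
  spherically_quasi_convex (@unit_sphere R n `&` @pos_orthant R n) (quad A) <->
  exists v : 'cV[R]_n,
    [/\ v != 0, A *m v = lmin *: v & forall i, 0 <= v i 0].
Proof.
have [|v [vv AE]] := two_eigenvalue_normal_form Asym (fun a => (hspec a).1) _ hmult.
  by move=> E; rewrite E ltxx in hlt.
have v1 : dot v v = 1.
  by have /matrixP/(_ 0 0) := vv; rewrite mulmx_tr_dot !mxE.
have gap : 0 < lmax - lmin by rewrite subr_gt0.
have Ax x : A *m x = lmax *: x - ((lmax - lmin) * dot v x) *: v.
  rewrite AE mulmxBl mul_scalar_mx -scalemxAl -mulmxA mulmx_tr_dot.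
  by rewrite mul_mx_scalar scalerA.
have qE x : dot x x = 1 -> quad A x = lmax - (lmax - lmin) * dot v x ^+ 2.
  move=> x1; rewrite /quad Ax dotDl dotNl !dotZl x1 mulr1; ring.
have Av : A *m v = lmin *: v by rewrite Ax v1 mulr1 -scalerBl subKr.
have v0 : v != 0.
  apply/eqP => v0; move: v1; rewrite v0 -(scale0r 0) dotZl mul0r => /esym/eqP.
  by rewrite oner_eq0.
split=> [qc|[w [w0 Aw wge0]]].
  have [/forallP vge0|] := boolP [forall i, 0 <= v i 0]; first by exists v.
  rewrite negb_forall => /existsP[j]; rewrite -ltNge => vj.
  exists (- v); split; [by rewrite oppr_eq0 | by rewrite mulmxN Av scalerN|].
  move=> i; rewrite mxE oppr_ge0 leNgt; apply/negP => vi.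
  exact: (not_quasi_convex_mixed_sign vi vj v1 gap qE qc).
(* The gap between the eigenvalues is nonzero, so [A *m w = lmin *: w] forces [w]
   onto the line of [v]; the sign of the factor disappears in the square. *)
have wE : w = dot v w *: v.
  move: Aw; rewrite Ax => /eqP; rewrite subr_eq addrC -subr_eq -scalerBl -scalerA.
  by move=> /eqP/scalerI; apply; rewrite gt_eqF.
have vw0 : dot v w != 0.
  by apply: contraNneq w0 => vw; rewrite wE vw scale0r.
apply: (@quasi_convex_sub_sqr_dot _ _ A w lmax ((lmax - lmin) / dot v w ^+ 2)).
- exact: wge0.
- by rewrite divr_ge0 ?sqr_ge0 // ltW.
- move=> x x1; rewrite qE //; congr (_ - _).
  have -> : dot w x = dot v w * dot v x by rewrite {1}wE dotZl.
  by field.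
Qed.
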